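(* Let $F$ be a field of characteristic $\neq 2$, let $O$ be a Cayley algebra over $F$, $V=\operatorname{im}(O)$ and $$\mathcal{B}=\{\operatorname{im}(H)\colon H\text{ is a 4-dimensional subalgebra of } O\}.$$ Then $(V,\mathcal{B})$ is a $(7,3,2)$ $q$-covering design (every 2-dimensional subspace of $V$ lies in at least one element of $\mathcal{B}$, and each element of $\mathcal{B}$ is 3-dimensional), it is inclusion-minimal (no proper subcollection of $\mathcal{B}$ covers all 2-dimensional subspaces of $V$), and it is a $2$-$(7,3,1)$ subspace design (every 2-dimensional subspace lies in exactly one element of $\mathcal{B}$) if and only if $O$ is a division algebra.
   Context: All algebras are finite-dimensional unital, not necessarily associative $F$-algebras; subalgebras contain $1$. An involution is a linear map $*$ with $(ab)^*=b^*a^*$, $(a^* )^*=a$. Cayley–Dickson algebras: $F$ (identity involution) is one; if $A$ is one with involution $*$ and $\gamma\in F^\times$, then $D_\gamma(A)=A\oplus A$ with elements written $a+ib$, multiplication $(a+ib)(c+id)=(ac+\gamma db^* )+i(a^*d+cb)$ and involution $(a+ib)^*=a^*-ib$ is one. A Cayley algebra is $D_\gamma(D_\beta(D_\alpha(F)))$ with $\alpha,\beta,\gamma\in F^\times$. $\operatorname{im}(H)=\{a\in H:a^*=-a\}$. A division algebra is one without zero divisors. A $(v,k,t)$ $q$-covering design on a $v$-dimensional space $V$ is a set of $k$-dimensional subspaces of $V$ such that every $t$-dimensional subspace of $V$ is contained in at least one of them. *)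

(* Defs.v *)
From HB Require Import structures.
From mathcomp Require Import all_boot all_order all_algebra.
Set Implicit Arguments. Unset Strict Implicit. Unset Printing Implicit Defensive.
Import GRing.Theory.
Local Open Scope ring_scope.

(* A Cayley-Dickson algebra of dimension d over F, modelled on row vectors
   'rV[F]_d: multiplication, involution (a linear map given by a matrix,
   x |-> x *m cdconj), and unit element. *)
Record CD (F : fieldType) (d : nat) := MkCD {
  cdmul  : 'rV[F]_d -> 'rV[F]_d -> 'rV[F]_d;
  cdconj : 'M[F]_d;
  cdone  : 'rV[F]_d }.

Definition CD_base (F : fieldType) : CD F 1 :=
  @MkCD F 1 (fun x y => scalar_mx (x ord0 ord0 * y ord0 ord0)) (scalar_mx 1) (scalar_mx 1).

(* D_gamma(A) = A (+) A, elements a + i b written as row_mx a b: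
   (a+ib)(c+id) = (ac + gamma d conj(b)) + i(conj(a) d + c b), conj(a+ib) = conj(a) - ib. *)
Definition CD_double (F : fieldType) (d : nat) (A : CD F d) (g : F)
  : CD F (d + d) :=
  let m := cdmul A in
  let cj := fun x : 'rV[F]_d => x *m cdconj A in
  @MkCD F (d + d)
    (fun x y =>
       let a := lsubmx x in let b := rsubmx x in
       let c := lsubmx y in let e := rsubmx y in
       row_mx (m a c + g *: m e (cj b)) (m (cj a) e + m c b))
    (block_mx (cdconj A) 0 0 (scalar_mx (-1)))
    (row_mx (cdone A) 0).

Definition cdim8 : nat := (1 + 1 + (1 + 1)) + (1 + 1 + (1 + 1)).

Definition Cayley (F : fieldType) (al be ga : F) : CD F cdim8 :=
  CD_double (CD_double (CD_double (CD_base F) al) be) ga.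

Section Notions.
Variables (F : fieldType) (d : nat) (A : CD F d).

Definition cd_conj (x : 'rV[F]_d) : 'rV[F]_d := x *m cdconj A.

(* im(A) = { a | a* = -a } = kernel of the linear map x |-> x* + x. *)
Definition cd_im : {vspace 'rV[F]_d} :=
  lker (linfun (fun x : 'rV[F]_d => x *m (cdconj A + scalar_mx 1))).

Definition cd_subalg (H : {vspace 'rV[F]_d}) : Prop :=
  cdone A \in H /\ forall x y, x \in H -> y \in H -> cdmul A x y \in H.

Definition cd_imsub (H : {vspace 'rV[F]_d}) : {vspace 'rV[F]_d} :=
  (H :&: cd_im)%VS.

Definition cd_block (W : {vspace 'rV[F]_d}) : Prop :=
  exists H : {vspace 'rV[F]_d}, [/\ cd_subalg H, \dim H = 4%N & W = cd_imsub H].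

Definition cd_division : Prop :=
  forall x y : 'rV[F]_d, cdmul A x y = 0 -> x = 0 \/ y = 0.
End Notions.

(* Main.v *)
Require Import Defs.
From HB Require Import structures.
From mathcomp Require Import all_boot all_order all_algebra.
From mathcomp Require Import ring.
From Stdlib Require Import Classical_Prop.
Set Implicit Arguments.
Unset Strict Implicit.
Unset Printing Implicit Defensive.
Import GRing.Theory.
Local Open Scope ring_scope.

(** Jacobson's doubling theorem shows that [O] is a composition algebra: it
    carries a nondegenerate symmetric form [<x, y>] with
    [<xy, xy> = <x, x><y, y>]. Hence [a(ax) = - <a, a> x = (xa)a] for imaginary
    [a], and [V] is the orthogonal of [1].

    A 4-dimensional subalgebra is spanned by [1], [a], [b], [ab] as soon as it
    contains imaginary [a, b] for which these four elements are independent, so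
    the plane [<a, b>] lies in exactly one block. Call [a, b] dependent
    otherwise. For a dependent pair the form is, up to sign, the square of a
    linear form on [<a, b>], and the plane is of one of two kinds:
    - [<a, a> = 0] and [ab = 0]: then [<a, b, e>] is a block, where [e = ac + 1]
      for any imaginary [c] with [<a, c> = 1] and [<b, c> = 0];
    - [<e, x>] with [e^2 = 1] and [ex = x]: then [<e, x, f>] is a block, where
      [ef = - f] and [<x, f> = 1].
    Every block contains an independent pair, which gives minimality: otherwise
    it would contain independent [x, y] with [xy = 0], and there would be [e]
    with [e^2 = 1], [ex = x], [ey = y], which contradicts
    [(xf)y + (xy)f = - 2<f, y>x], where [ef = - f], [<x, f> = 1] and
    [<y, f> = 0].

    In a division algebra every pair is independent. Conversely, zero divisors
    yield a plane [<a, b>] of the first kind, and then [<e, b>] lies in the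
    blocks [<a, b, e>] and [<e, b, f>], which differ because [b] is orthogonal
    to the first one while [<b, f> = 1]. *)

Ltac row_ring := apply/rowP => ?; rewrite !mxE; ring.
Ltac row_field := apply/rowP => ?; rewrite !mxE; field.

(** * Linear algebra *)

Section VectorSpace.
Variables (K : fieldType) (vT : vectType K).
Implicit Types (a b c u x y : vT) (X : seq vT) (U W : {vspace vT}).

Lemma free_cons_coef u X (s : K) x : free (u :: X) -> x \in <<X>>%VS ->
  s *: u + x = 0 -> s = 0 /\ x = 0.
Proof.
rewrite free_cons => /andP[uNX _] xX /eqP; rewrite addr_eq0 => /eqP su.
have s0 : s = 0.
  apply: contraNeq uNX => s_neq0.
  by rewrite -(scalerK s_neq0 u) su memvZ ?memvN.
by split=> //; apply: oppr_inj; rewrite -su s0 scale0r oppr0.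
Qed.

Lemma free2_coef a b (s t : K) : free [:: a; b] -> s *: a + t *: b = 0 ->
  s = 0 /\ t = 0.
Proof.
move=> free_ab eq0; have b0 : b != 0.
  by rewrite (free_not0 free_ab) // !inE eqxx orbT.
have [|-> /eqP] := free_cons_coef free_ab _ eq0.
  by rewrite memvZ ?memv_span1.
by rewrite scaler_eq0 (negPf b0) orbF => /eqP.
Qed.

Lemma free3_coef a b c (r s t : K) : free [:: a; b; c] ->
  r *: a + (s *: b + t *: c) = 0 -> [/\ r = 0, s = 0 & t = 0].
Proof.
move=> free_abc eq0; have [|-> st0] := free_cons_coef free_abc _ eq0.
  by rewrite memvD ?memvZ ?memv_span // !inE eqxx ?orbT.
by have [|-> ->] := free2_coef _ st0; first exact: catr_free [:: a] _ _.
Qed.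

Lemma span3P a b c x : x \in <<[:: a; b; c]>>%VS ->
  exists r s t, x = r *: a + (s *: b + t *: c).
Proof.
rewrite !span_cons span_nil addv0 => /memv_addP[_ /vlineP[r ->]].
case=> _ /memv_addP[_ /vlineP[s ->] [_ /vlineP[t ->] ->]] ->.
by exists r, s, t.
Qed.

Lemma free_pairC a b : free [:: a; b] = free [:: b; a].
Proof. exact: perm_free (permEl (perm_catC [:: a] [:: b])). Qed.

Lemma eigenvalue_eq (f : vT -> vT) x y (r s t : K) : free [:: x; y] ->
  f x = r *: x -> f y = s *: y -> f x + f y = t *: (x + y) -> r = s.
Proof.
move=> free_xy -> -> fxy.
have [|rt st] := free2_coef (s := r - t) (t := s - t) free_xy.
  by rewrite !scalerBl addrACA -opprD -scalerDr fxy subrr.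
by apply: (addIr (- t)); rewrite rt st.
Qed.

Lemma dimv_lt_notin U W : (\dim U < \dim W)%N ->
  exists2 w, w \in W & w \notin U.
Proof.
by move=> ltUW; apply/subvPn; apply: contraL ltUW => /dimvS; rewrite -leqNgt.
Qed.

Lemma free_seq_sub U n : (n <= \dim U)%N ->
  exists X, [/\ size X = n, free X & {subset X <= U}].
Proof.
move=> le_n; exists (take n (vbasis U)); split=> [||x /mem_take/vbasis_mem //].
  by rewrite size_takel // size_tuple.
apply: (@catl_free _ _ (drop n (vbasis U))).
by rewrite cat_take_drop (basis_free (vbasisP U)).
Qed.

Lemma free_pair_sub U : (1 < \dim U)%N ->
  exists a b, [/\ free [:: a; b], a \in U & b \in U].
Proof.
move=> /free_seq_sub[X []]; case: X => [|a [|b []]] //= _ free_ab abU.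
by exists a, b; split=> //; apply: abU; rewrite !inE eqxx ?orbT.
Qed.

Lemma plane_span U : \dim U = 2%N ->
  exists a b, [/\ free [:: a; b], a \in U, b \in U & U = <<[:: a; b]>>%VS].
Proof.
move=> dimU; have [|a [b [free_ab aU bU]]] := @free_pair_sub U.
  by rewrite dimU.
exists a, b; split=> //; apply/esym/eqP.
rewrite eqEdim (eqP free_ab) dimU leqnn andbT; apply/span_subvP => x.
by rewrite !inE => /orP[]/eqP->.
Qed.
End VectorSpace.

Lemma dim_rV (K : fieldType) d : \dim {:'rV[K]_d} = d.
Proof. by rewrite dimvf /dim /= mul1n. Qed.

Section SymmetricForm.
Variables (F : fieldType) (d : nat) (f : {symmetric 'rV[F]_d}).

Lemma notin_span_orth c u (X : seq 'rV[F]_d) :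
  all (fun x => f x c == 0) X -> f u c != 0 -> u \notin <<X>>%VS.
Proof.
move=> /allP Xc; apply: contra; rewrite -mem_orthov1; apply/subvP.
by apply/span_subvP => x xX; rewrite mem_orthov1; apply: Xc.
Qed.

Lemma free_cons_orth c u (X : seq 'rV[F]_d) :
  all (fun x => f x c == 0) X -> f u c != 0 -> free X -> free (u :: X).
Proof. by move=> Xc uc freeX; rewrite free_cons freeX (notin_span_orth Xc). Qed.

Hypothesis f_nd : nondegenerate f.

Lemma nondegenerate_ext x y : f x =1 f y -> x = y.
Proof.
move=> fxy; apply/eqP; rewrite -subr_eq0 -memv0 -(eqP f_nd).
by apply/mem_orthovP => z _; rewrite linearBl /= fxy subrr.
Qed.

Lemma nondegenerate_riesz (phi : {linear 'rV[F]_d -> F^o}) :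
  exists c, f ^~ c =1 phi.
Proof.
pose coords (c : 'rV[F]_d) : 'rV[F]_d := \row_i f c (delta_mx 0 i).
have coords_linear : linear coords.
  by move=> s x y; apply/rowP => i; rewrite !mxE linearPl.
pose T : 'End('rV[F]_d) := linfun (HB.pack coords
  (GRing.isLinear.Build _ _ _ _ coords coords_linear) : {linear _ -> _}).
have TE c i : T c 0 i = f c (delta_mx 0 i) by rewrite lfunE mxE.
have T_inj : lker T == 0%VS.
  apply/lker0P => x y /rowP Txy; apply: nondegenerate_ext => z.
  rewrite (row_sum_delta z) !linear_sumr; apply: eq_bigr => i _.
  by rewrite !linearZr_LR /= -!TE Txy.
pose phis : 'rV[F]_d := \row_i phi (delta_mx 0 i).
have /memv_imgP[c _ phisE] : phis \in limg T by rewrite lker0_limgf ?memvf.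
exists c => z; rewrite hermC mul1r /= (row_sum_delta z) linear_sumr linear_sum.
by apply: eq_bigr => i _; rewrite linearZr_LR linearZ /= -TE -phisE mxE.
Qed.

Lemma nondegenerate_interpolation (X : seq 'rV[F]_d) (v : seq F) :
  free X -> size v = size X -> exists c, [seq f x c | x <- X] = v.
Proof.
move=> freeX size_v.
have [phi /(_ freeX size_v) <-] := linear_of_free X (v : seq F^o).
by have [c phiE] := nondegenerate_riesz phi; exists c; apply: eq_map.
Qed.
End SymmetricForm.

Section DoubleForm.
Variables (F : fieldType) (m n : nat).
Variables (f : {symmetric 'rV[F]_m}) (f' : {symmetric 'rV[F]_n}) (g : F).

Definition double_form (x y : 'rV[F]_(m + n)) : F :=
  f (lsubmx x) (lsubmx y) - g * f' (rsubmx x) (rsubmx y).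

Lemma double_form_bilinear : bilinear_for *%R (idfun \; *%R) double_form.
Proof.
by split=> u s x y; rewrite /double_form !linearP ?linearPl /=; ring.
Qed.

Lemma double_form_hermitian x y :
  double_form x y = (-1) ^+ false * idfun (double_form y x).
Proof. by rewrite /double_form mul1r hermC mul1r [f' _ _]hermC mul1r. Qed.

HB.instance Definition _ := bilinear_isBilinear.Build F
  'rV[F]_(m + n) 'rV[F]_(m + n) F *%R (idfun \; *%R) double_form
  double_form_bilinear.
HB.instance Definition _ := isHermitianSesquilinear.Build F
  'rV[F]_(m + n) false idfun double_form double_form_hermitian.

Lemma double_formE a b c e :
  double_form (row_mx a b) (row_mx c e) = f a c - g * f' b e.
Proof. by rewrite /double_form !row_mxKl !row_mxKr. Qed.

Lemma double_form_nondegenerate : g != 0 ->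
  nondegenerate f -> nondegenerate f' -> nondegenerate double_form.
Proof.
move=> g0 f_nd f'_nd; rewrite /nondegenerate -subv0; apply/subvP => x x_orth.
have {}x_orth y : double_form x y = 0.
  by move/mem_orthovP: x_orth; apply; apply: memvf.
rewrite memv0 -[x]hsubmxK; apply/eqP.
rewrite -[RHS](row_mx0 F 1 m n); congr row_mx.
  apply: (nondegenerate_ext f_nd) => y; rewrite linear0l.
  by have := x_orth (row_mx y 0); rewrite -{1}[x]hsubmxK double_formE linear0r
    mulr0 subr0.
apply: (nondegenerate_ext f'_nd) => y; rewrite linear0l; apply: (mulfI g0).
have := x_orth (row_mx 0 y); rewrite -{1}[x]hsubmxK double_formE linear0r sub0r.
by rewrite mulr0 => /eqP; rewrite oppr_eq0 => /eqP.
Qed.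
End DoubleForm.

(** * Composition algebras *)

(* [form x x] is the norm of [x], so [form] is half of the usual polar form and
   [2 * form x 1] is the trace of [x]. *)
Record composition_form (F : fieldType) (d : nat) (A : CD F d)
    (form : {symmetric 'rV[F]_d}) : Prop := CompositionForm {
  comp_mul_linearl y : linear (cdmul A ^~ y);
  comp_mul_linearr x : linear (cdmul A x);
  comp_mul1x : left_id (cdone A) (cdmul A);
  comp_mulx1 : right_id (cdone A) (cdmul A);
  comp_nondegenerate : nondegenerate form;
  comp_form11 : form (cdone A) (cdone A) = 1;
  comp_formM x y :
    form (cdmul A x y) (cdmul A x y) = form x x * form y y;
  comp_conjE x : cd_conj A x = (2%:R * form x (cdone A)) *: cdone A - x }.

Lemma CD_double_mul (F : fieldType) (d : nat) (A : CD F d) (g : F)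
    (a b c e : 'rV[F]_d) :
  cdmul (CD_double A g) (row_mx a b) (row_mx c e) =
  row_mx (cdmul A a c + g *: cdmul A e (cd_conj A b))
         (cdmul A (cd_conj A a) e + cdmul A c b).
Proof. by rewrite /= !row_mxKl !row_mxKr. Qed.

Lemma CD_double_conj (F : fieldType) (d : nat) (A : CD F d) (g : F)
    (a b : 'rV[F]_d) :
  cd_conj (CD_double A g) (row_mx a b) = row_mx (cd_conj A a) (- b).
Proof.
by rewrite /cd_conj /= mul_row_block !mulmx0 addr0 add0r mul_mx_scalar scaleN1r.
Qed.

Section CompositionAlgebra.
Variables (F : fieldType) (d : nat) (A : CD F d) (form : {symmetric 'rV[F]_d}).
Hypothesis compA : composition_form A form.
Hypothesis two_neq0 : 2%:R != 0 :> F.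

Local Notation "x ** y" := (cdmul A x y) (at level 40, left associativity).
Local Notation "x ^*" := (cd_conj A x) : ring_scope.
Local Notation one := (cdone A).
Local Notation "'[ x , y ]" := (form x y).
Local Notation V := (cd_im A).
Implicit Types (a b c e f u w x y z : 'rV[F]_d) (X : seq 'rV[F]_d).
Implicit Types (H U W P : {vspace 'rV[F]_d}).

HB.instance Definition _ := bilinear_isBilinear.Build F
  'rV[F]_d 'rV[F]_d 'rV[F]_d *:%R *:%R (cdmul A)
  (comp_mul_linearl compA, comp_mul_linearr compA).

HB.instance Definition _ x := GRing.isLinear.Build F
  'rV[F]_d 'rV[F]_d *:%R (cdmul A x) (comp_mul_linearr compA x).

Let mul1x := comp_mul1x compA.
Let mulx1 := comp_mulx1 compA.
Let form11 := comp_form11 compA.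
Let formM := comp_formM compA.
Let conjE := comp_conjE compA.
Let form_ext := nondegenerate_ext (comp_nondegenerate compA).
Let form_interpolation :=
  nondegenerate_interpolation (comp_nondegenerate compA).

Let mulDl x y z : (x + y) ** z = x ** z + y ** z := linearDl _ z x y.
Let mulDr x y z : z ** (x + y) = z ** x + z ** y := linearDr _ z x y.
Let mulNl x y : (- x) ** y = - (x ** y) := linearNl _ y x.
Let mulNr x y : y ** (- x) = - (y ** x) := linearNr _ y x.
Let mulZl s x y : (s *: x) ** y = s *: (x ** y) := linearZl_LR _ y s x.
Let mulZr s x y : y ** (s *: x) = s *: (y ** x) := linearZr_LR _ y s x.
Let mul0x x : 0 ** x = 0 := linear0l _ x.
Let mulx0 x : x ** 0 = 0 := linear0r _ x.
Let mulE :=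
  (mulDl, mulDr, mulNl, mulNr, mulZl, mulZr, mul0x, mulx0, mul1x, mulx1).

Let formDl x y z : '[x + y, z] = '[x, z] + '[y, z] := linearDl _ z x y.
Let formDr x y z : '[z, x + y] = '[z, x] + '[z, y] := linearDr _ z x y.
Let formNl x y : '[- x, y] = - '[x, y] := linearNl _ y x.
Let formNr x y : '[y, - x] = - '[y, x] := linearNr _ y x.
Let formZl s x y : '[s *: x, y] = s * '[x, y] := linearZl_LR _ y s x.
Let formZr s x y : '[y, s *: x] = s * '[y, x] := linearZr_LR _ y s x.
Let form0l x : '[0, x] = 0 := linear0l _ x.
Let form0r x : '[x, 0] = 0 := linear0r _ x.
Let formE :=
  (formDl, formDr, formNl, formNr, formZl, formZr, form0l, form0r, form11).

Let conjD x y : (x + y)^* = x^* + y^* := mulmxDl _ _ _.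
Let conjZ s x : (s *: x)^* = s *: x^* := esym (scalemxAl _ _ _).

Lemma comp_formC x y : '[x, y] = '[y, x].
Proof. by rewrite hermC mul1r. Qed.
Local Notation formC := comp_formC.

Lemma comp_form_neq0 x y : '[x, y] != 0 -> x != 0.
Proof. by apply: contraNneq => ->; rewrite form0l. Qed.

Lemma comp_one_neq0 : one != 0.
Proof. by apply: (@comp_form_neq0 _ one); rewrite form11 oner_eq0. Qed.

Lemma comp_polarization x y :
  2%:R * '[x, y] = '[x + y, x + y] - '[x, x] - '[y, y].
Proof. by rewrite !formE (formC y x); ring. Qed.

Lemma comp_form_similarl x y z : '[x ** y, x ** z] = '[x, x] * '[y, z].
Proof.
apply: (mulfI two_neq0); rewrite comp_polarization -linearDr !formM.
by rewrite mulrCA comp_polarization; ring.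
Qed.

Lemma comp_form_similarr x y z : '[y ** x, z ** x] = '[y, z] * '[x, x].
Proof.
apply: (mulfI two_neq0); rewrite comp_polarization -linearDl !formM.
by rewrite mulrA comp_polarization; ring.
Qed.

Lemma comp_form_adjl x y z : '[x ** y, z] = '[y, x^* ** z].
Proof.
have -> : '[x ** y, z] = '[(x + one) ** y, (x + one) ** z] - '[x ** y, x ** z]
    - '[y, x ** z] - '[y, z] by rewrite !mulE !formE; ring.
by rewrite !comp_form_similarl conjE !mulE !formE (formC one); ring.
Qed.

Lemma comp_form_adjr x y z : '[y ** x, z] = '[y, z ** x^*].
Proof.
have -> : '[y ** x, z] = '[y ** (x + one), z ** (x + one)] - '[y ** x, z ** x]
    - '[y, z ** x] - '[y, z] by rewrite !mulE !formE; ring.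
by rewrite !comp_form_similarr conjE !mulE !formE (formC one); ring.
Qed.

Lemma comp_form_conj x y : '[x^*, y^*] = '[x, y].
Proof. by rewrite !conjE !formE !(formC one); ring. Qed.

Lemma comp_conjK : involutive (cd_conj A).
Proof. by move=> x; rewrite !conjE !formE; row_ring. Qed.

Lemma comp_conjM x y : (x ** y)^* = y^* ** x^*.
Proof.
apply: form_ext => z.
rewrite -{1}[z]comp_conjK comp_form_conj comp_form_adjr.
by rewrite [RHS]comp_form_adjr comp_conjK [RHS]formC comp_form_adjl.
Qed.

Lemma comp_mul_conjl x y : x^* ** (x ** y) = '[x, x] *: y.
Proof.
apply: form_ext => z.
by rewrite comp_form_adjl comp_conjK comp_form_similarl !formE.
Qed.

Lemma comp_mul_conjr x y : (y ** x) ** x^* = '[x, x] *: y.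
Proof.
apply: form_ext => z.
by rewrite comp_form_adjr comp_conjK comp_form_similarr !formE mulrC.
Qed.

(** * The Cayley-Dickson doubling *)

Section Doubling.
Variable g : F.
Local Notation DA := (CD_double A g).

Lemma CD_double_commutative : commutative (cdmul A) -> cd_conj A =1 id ->
  commutative (cdmul DA).
Proof.
move=> mulC conj_id x y.
rewrite -[x]hsubmxK -[y]hsubmxK !CD_double_mul !conj_id.
congr (row_mx (_ + g *: _) _); [exact: mulC | exact: mulC |].
by rewrite addrC; congr (_ + _); exact: mulC.
Qed.

Lemma CD_double_associative : commutative (cdmul A) -> associative (cdmul A) ->
  associative (cdmul DA).
Proof.
move=> mulC mulA x y z.
rewrite -[x]hsubmxK -[y]hsubmxK -[z]hsubmxK !CD_double_mul.
move: (lsubmx x) (rsubmx x) (lsubmx y) (rsubmx y) (lsubmx z) (rsubmx z).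
move=> a b c e u v; rewrite !(conjD, conjZ, comp_conjM, comp_conjK, mulE).
congr row_mx.
- have -> : (e ** b^*) ** u = (u ** e) ** b^* by rewrite mulC mulA.
  have -> : v ** (e^* ** a) = a ** (v ** e^*) by rewrite mulA mulC.
  have -> : v ** (b^* ** c^*) = (c^* ** v) ** b^*.
    by rewrite (mulC b^*) mulA (mulC v).
  by rewrite mulA; row_ring.
- have -> : (c^* ** a^*) ** v = a^* ** (c^* ** v) by rewrite (mulC c^*) -mulA.
  have -> : (b ** e^*) ** v = (v ** e^*) ** b by rewrite mulC (mulC b) mulA.
  have -> : u ** (a^* ** e) = a^* ** (u ** e) by rewrite !mulA (mulC u).
  have -> : u ** (c ** b) = (c ** u) ** b by rewrite mulA (mulC u).
  by row_ring.
Qed.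

Lemma CD_double_linearl (y : 'rV[F]_(d + d)) : linear (cdmul DA ^~ y).
Proof.
move=> s u v; rewrite /= !linearP /= scale_row_mx add_row_mx.
rewrite !mulmxDl -!scalemxAl.
by congr row_mx; rewrite !mulE; row_ring.
Qed.

Lemma CD_double_linearr (x : 'rV[F]_(d + d)) : linear (cdmul DA x).
Proof.
move=> s u v; rewrite /= !linearP /= scale_row_mx add_row_mx.
by congr row_mx; rewrite !mulE; row_ring.
Qed.

Lemma CD_double_formM (x y : 'rV[F]_(d + d)) : associative (cdmul A) ->
  double_form form form g (cdmul DA x y) (cdmul DA x y) =
  double_form form form g x x * double_form form form g y y.
Proof.
move=> mulA; rewrite -[x]hsubmxK -[y]hsubmxK CD_double_mul !double_formE.
move: (lsubmx x) (rsubmx x) (lsubmx y) (rsubmx y) => a b c e.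
have cross : '[a ** c, e ** b^*] = '[a^* ** e, c ** b].
  by rewrite [RHS]comp_form_adjl comp_conjK mulA [RHS]formC [RHS]comp_form_adjr.
rewrite !formE !formM !comp_form_conj (formC _ (a ** c)) cross.
by rewrite (formC (c ** b)); ring.
Qed.

Lemma CD_double_composition : g != 0 -> associative (cdmul A) ->
  composition_form DA (double_form form form g).
Proof.
have oneE : cdone DA = row_mx one 0 by [].
have conj1 : one^* = one by rewrite conjE !formE; row_ring.
move=> g0 mulA; have form_nd := comp_nondegenerate compA; split; rewrite ?oneE.
- exact: CD_double_linearl.
- exact: CD_double_linearr.
- move=> x; rewrite -[x]hsubmxK CD_double_mul conj1 /cd_conj mul0mx.
  by rewrite !mulE scaler0 !addr0.
- move=> x; rewrite -[x]hsubmxK CD_double_mul.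
  by rewrite !mulE scaler0 addr0 add0r.
- exact: double_form_nondegenerate.
- by rewrite /= double_formE !formE mulr0 subr0.
- by move=> x y; apply: CD_double_formM.
- move=> x; rewrite -[x]hsubmxK CD_double_conj /= double_formE form0r.
  by rewrite conjE mulr0 subr0 scale_row_mx opp_row_mx add_row_mx scaler0 add0r.
Qed.

End Doubling.

(** * Imaginary elements *)

Lemma mem_cd_im x : (x \in V) = ('[x, one] == 0).
Proof.
have -> : V = lker (linfun (mulmxr (cdconj A + 1%:M))) by [].
rewrite memv_ker lfunE /= mulmxDr mulmx1 -/(cd_conj A x) conjE subrK.
by rewrite scaler_eq0 mulf_eq0 (negPf two_neq0) (negPf comp_one_neq0) orbF.
Qed.

Lemma im_form1 a : a \in V -> '[a, one] = 0.
Proof. by rewrite mem_cd_im => /eqP. Qed.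

Lemma conj_im a : a \in V -> a^* = - a.
Proof. by move=> aV; rewrite conjE im_form1 // mulr0 scale0r add0r. Qed.

Lemma im_form_mull a x y : a \in V -> '[a ** x, y] = - '[x, a ** y].
Proof. by move=> aV; rewrite comp_form_adjl conj_im // mulE formE. Qed.

Lemma im_mul_sqrl a x : a \in V -> a ** (a ** x) = - '[a, a] *: x.
Proof.
by move=> aV; rewrite scaleNr -comp_mul_conjl conj_im // mulNl opprK.
Qed.

Lemma im_mul_sqrr a x : a \in V -> (x ** a) ** a = - '[a, a] *: x.
Proof.
by move=> aV; rewrite scaleNr -comp_mul_conjr conj_im // mulNr opprK.
Qed.

Lemma im_mul_anticommutel a b x : a \in V -> b \in V ->
  a ** (b ** x) + b ** (a ** x) = - (2%:R * '[a, b]) *: x.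
Proof.
move=> aV bV.
have -> : a ** (b ** x) + b ** (a ** x) =
    (a + b) ** ((a + b) ** x) - a ** (a ** x) - b ** (b ** x).
  by rewrite !mulE; row_ring.
by rewrite !im_mul_sqrl ?memvD // !formE (formC b a); row_ring.
Qed.

Lemma im_mul_anticommuter a b x : a \in V -> b \in V ->
  (x ** a) ** b + (x ** b) ** a = - (2%:R * '[a, b]) *: x.
Proof.
move=> aV bV.
have -> : (x ** a) ** b + (x ** b) ** a =
    (x ** (a + b)) ** (a + b) - (x ** a) ** a - (x ** b) ** b.
  by rewrite !mulE; row_ring.
by rewrite !im_mul_sqrr ?memvD // !formE (formC b a); row_ring.
Qed.

Lemma im_sqr a : a \in V -> a ** a = - '[a, a] *: one.
Proof. by move=> aV; rewrite -{2}[a]mulx1 im_mul_sqrl. Qed.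

Lemma im_mulC a b : a \in V -> b \in V ->
  b ** a = - (a ** b) - (2%:R * '[a, b]) *: one.
Proof.
move=> aV bV; have := im_mul_anticommutel one aV bV.
by rewrite !mulx1 scaleNr => <-; rewrite addKr.
Qed.

Lemma im_form_mul1 a b : a \in V -> '[a ** b, one] = - '[a, b].
Proof. by move=> aV; rewrite im_form_mull // mulx1 formC. Qed.

Lemma im_mul_orth a b : a \in V -> a ** b \in V -> '[a, b] = 0.
Proof.
by move=> aV /im_form1/eqP; rewrite im_form_mul1 // oppr_eq0 => /eqP.
Qed.

Lemma free_one_im X : all [in V] X -> free X -> free (one :: X).
Proof.
move=> XV; apply: (free_cons_orth (f := form) (c := one)).
  by rewrite (eq_all (a2 := [in V])) // => x; rewrite /= mem_cd_im.
by rewrite form11 oner_eq0.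
Qed.

(** * Blocks through a given plane *)

Lemma span_mul_closed X : {in X &, forall x y, x ** y \in <<X>>%VS} ->
  {in <<X>>%VS &, forall x y, x ** y \in <<X>>%VS}.
Proof.
move=> mulX x y xX yX.
have mulXl z : z \in X -> z ** y \in <<X>>%VS.
  move=> zX; have /subvP/(_ y yX) :
      (<<X>> <= linfun (cdmul A z) @^-1: <<X>>)%VS.
    by apply/span_subvP => w wX; rewrite -memv_preim lfunE mulX.
  by rewrite -memv_preim lfunE.
have /subvP/(_ x xX) : (<<X>> <= linfun (applyr (cdmul A) y) @^-1: <<X>>)%VS.
  by apply/span_subvP => z zX; rewrite -memv_preim lfunE mulXl.
by rewrite -memv_preim lfunE.
Qed.

Lemma subalg_span_im X : all [in V] X ->
  pairwise (fun x y => x ** y \in <<one :: X>>%VS) X ->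
  cd_subalg A <<one :: X>>.
Proof.
move=> /allP XV mulX; have oneX : one \in <<one :: X>>%VS.
  by rewrite memv_span ?mem_head.
split=> //; apply: span_mul_closed => x y.
have memX z : z \in X -> z \in <<one :: X>>%VS.
  by move=> zX; rewrite memv_span // inE zX orbT.
rewrite !inE => /predU1P[->|xX] /predU1P[->|yX]; rewrite ?mul1x ?mulx1 //.
- exact: memX.
- exact: memX.
have mulC z w : z \in X -> w \in X -> z ** w \in <<one :: X>>%VS ->
    w ** z \in <<one :: X>>%VS.
  by move=> /XV zV /XV wV zw; rewrite im_mulC // memvB ?memvN ?memvZ.
have [xy|yx|xy] := ltngtP (index x X) (index y X).
- have /(pairwiseP 0)/(_ _ _ _ _ xy) := mulX.
  by rewrite !nth_index //; apply; rewrite inE index_mem.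
- apply: mulC => //; have /(pairwiseP 0)/(_ _ _ _ _ yx) := mulX.
  by rewrite !nth_index //; apply; rewrite inE index_mem.
- have <- : x = y by rewrite -(nth_index 0 xX) xy nth_index.
  by rewrite im_sqr ?memvZ // XV.
Qed.

Lemma imsub_span_im X : all [in V] X -> cd_imsub A <<one :: X>> = <<X>>%VS.
Proof.
move=> /allP XV; apply/eqP; rewrite eqEsubv subv_cap.
have sub_XV : (<<X>> <= V)%VS by apply/span_subvP.
rewrite sub_XV span_cons addvSr !andbT; apply/subvP => x /memv_capP[].
case/memv_addP=> _ /vlineP[s ->] [w wX ->] /im_form1.
rewrite !formE (im_form1 (subvP sub_XV w wX)) mulr1 addr0 => ->.
by rewrite scale0r add0r.
Qed.

Lemma block_span_im X : size X = 3%N -> free X -> all [in V] X ->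
  pairwise (fun x y => x ** y \in <<one :: X>>%VS) X -> cd_block A <<X>>.
Proof.
move=> sizeX freeX XV mulX; exists <<one :: X>>%VS; split.
- exact: subalg_span_im.
- by have /eqP -> := free_one_im XV freeX; rewrite /= sizeX.
- by rewrite imsub_span_im.
Qed.

Lemma im_form_mul_self a x : a \in V -> '[x, a ** x] = 0.
Proof.
move=> aV; have /eqP := im_form_mull x x aV; rewrite formC -subr_eq0 opprK.
by rewrite -mulr2n -mulr_natl mulf_eq0 (negPf two_neq0) => /eqP.
Qed.

Definition dependent_pair a b := a ** b \in <<[:: one; a; b]>>%VS.

Lemma dependent_pair_mul a b : a \in V -> b \in V -> free [:: a; b] ->
  dependent_pair a b -> exists y z : F,
  [/\ '[a, a] = - z ^+ 2, '[b, b] = - y ^+ 2, '[a, b] = y * z &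
      a ** b = - (y * z) *: one + y *: a + z *: b].
Proof.
move=> aV bV free_ab /span3P[x [y [z abE]]].
have free_1ab : free [:: one; a; b] by apply: free_one_im; rewrite //= aV bV.
have form_ab : '[a, b] = - x.
  apply: oppr_inj; rewrite -im_form_mul1 // abE !formE !im_form1 //; ring.
have [|_ xE zz] := free3_coef (r := z * x - y * '[a, a]) (s := x + z * y)
  (t := z ^+ 2 + '[a, a]) free_1ab.
  have := im_mul_sqrl b aV; rewrite {1}abE !mulE im_sqr // abE => /eqP.
  rewrite -subr_eq0 => /eqP <-; row_ring.
have [|_ yy _] := free3_coef (r := y * x - z * '[b, b]) (s := y ^+ 2 + '[b, b])
  (t := x + y * z) free_1ab.
  have := im_mul_sqrr a bV; rewrite {1}abE !mulE (im_sqr bV) // abE => /eqP.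
  rewrite -subr_eq0 => /eqP <-; row_ring.
have {}xE : x = - (y * z) by apply/eqP; rewrite -addr_eq0 mulrC xE.
exists y, z; split; last by rewrite abE xE addrA.
- by apply/eqP; rewrite -addr_eq0 addrC zz.
- by apply/eqP; rewrite -addr_eq0 addrC yy.
- by rewrite form_ab xE opprK.
Qed.

Lemma isotropic_dependent_mul a b : a \in V -> b \in V -> free [:: a; b] ->
  dependent_pair a b -> '[a, a] = 0 -> '[b, b] = 0 -> a ** b = 0.
Proof.
move=> aV bV free_ab /(dependent_pair_mul aV bV free_ab)[y [z [-> -> _ ->]]].
move=> /eqP; rewrite oppr_eq0 sqrf_eq0 => /eqP->.
move=> /eqP; rewrite oppr_eq0 sqrf_eq0 => /eqP->.
by rewrite mulr0 oppr0 !scale0r !addr0.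
Qed.

Section Involution.
Variable e : 'rV[F]_d.
Hypotheses (eV : e \in V) (form_ee : '[e, e] = -1).

Lemma free_involution X : all (fun x => '[x, e] == 0) X -> free X ->
  free (e :: X).
Proof.
by move=> Xe; apply: free_cons_orth Xe _; rewrite form_ee oppr_eq0 oner_eq0.
Qed.

Lemma fixed_isotropic x : e ** x = x -> '[x, x] = 0.
Proof. by move=> ex; rewrite -{2}ex im_form_mul_self. Qed.

Lemma fixed_orth x : x \in V -> e ** x = x -> '[x, e] = 0.
Proof. by move=> xV ex; rewrite formC im_mul_orth // ex. Qed.

Lemma antifixed_orth f : f \in V -> e ** f = - f -> '[f, e] = 0.
Proof. by move=> fV ef; rewrite formC im_mul_orth // ef memvN. Qed.

Lemma fixed_mul_antifixed x f : x \in V -> f \in V ->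
  e ** x = x -> e ** f = - f -> x ** f = - '[x, f] *: (one + e).
Proof.
move=> xV fV ex ef; have [xe fe] := (fixed_orth xV ex, antifixed_orth fV ef).
have e_xf : e ** (x ** f) = x ** f.
  have := im_mul_anticommutel f eV xV.
  rewrite ef formC xe !mulE mulr0 oppr0 scale0r.
  by move/eqP; rewrite subr_eq0 => /eqP.
have xe_neg : x ** e = - x.
  by rewrite im_mulC // ex formC xe mulr0 scale0r subr0.
have xf_e : (x ** f) ** e = x ** f.
  have := im_mul_anticommuter x fV eV.
  rewrite xe_neg fe !mulE mulr0 oppr0 scale0r.
  by move/eqP; rewrite subr_eq0 => /eqP.
have imV : x ** f + '[x, f] *: one \in V.
  by rewrite mem_cd_im !formE im_form_mul1 // mulr1 addNr.
have := im_mul_anticommutel one eV imV; rewrite !mulx1 !mulE e_xf xf_e formDr.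
rewrite formZr (im_form1 eV) mulr0 addr0 (formC e) im_form_mull // xe_neg.
rewrite formNr opprK (formC f) => /eqP; rewrite -subr_eq0 => /eqP anti.
apply: (scalerI two_neq0); apply/eqP; rewrite -subr_eq0 -[X in _ == X]anti.
by apply/eqP; row_ring.
Qed.

Lemma antifixed_interpolation X (v : seq F) : all [in V] X ->
  all (fun x => e ** x == x) X -> free X -> size v = size X ->
  exists f, [/\ f \in V, e ** f = - f & [seq '[x, f] | x <- X] = v].
Proof.
move=> XV /allP Xfix freeX size_v.
have free_1eX : free [:: one, e & X].
  rewrite free_one_im /= ?eV // free_involution //; apply/allP => x xX.
  by apply/eqP/fixed_orth; [exact: (allP XV) | apply/eqP/Xfix].
have [|c [onec ec Xc]] := form_interpolation (v := [:: 0, 0 & v]) free_1eX.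
  by rewrite /= size_v.
exists (2%:R^-1 *: (c - e ** c)); split.
- rewrite mem_cd_im !formE im_form_mul1 // ec (formC c) onec.
  by rewrite !oppr0 addr0 mulr0.
- by rewrite !mulE im_mul_sqrl // form_ee; row_ring.
rewrite -Xc; apply/eq_in_map => x xX; rewrite !formE.
have /eqP ex := Xfix x xX; have := im_form_mull x c eV; rewrite ex => <-.
by field.
Qed.

Lemma fixed_mul_neq0 x y : x \in V -> y \in V -> e ** x = x -> e ** y = y ->
  free [:: x; y] -> x ** y != 0.
Proof.
move=> xV yV ex ey free_xy; apply/eqP => xy.
have [||||f [fV ef [xf yf]]] := @antifixed_interpolation [:: x; y] [:: 1; 0].
- by rewrite /= xV yV.
- by rewrite /= ex ey !eqxx.
- by [].
- by [].
have := im_mul_anticommuter x fV yV.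
rewrite (fixed_mul_antifixed xV fV ex ef) xf xy !mulE ey.
rewrite (formC f) yf mulr0 oppr0 scale0r addr0 scaleN1r => /eqP.
rewrite oppr_eq0 -mulr2n -scaler_nat scaler_eq0 (negPf two_neq0) /=.
by rewrite (negPf (free_not0 free_xy _)) // !inE eqxx orbT.
Qed.

Lemma block_fixed x : x \in V -> e ** x = x -> x != 0 ->
  exists2 f, '[x, f] = 1 & cd_block A <<[:: f; e; x]>>.
Proof.
move=> xV ex x0.
have [||||f [fV ef [xf]]] := @antifixed_interpolation [:: x] [:: 1].
- by rewrite /= xV.
- by rewrite /= ex eqxx.
- by rewrite seq1_free.
- by [].
have xe := fixed_orth xV ex.
exists f => //; apply: block_span_im => //=; rewrite ?fV ?eV ?xV //.
  apply: (free_cons_orth (f := form) (c := x)) => /=.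
  - by rewrite formC xe fixed_isotropic ?eqxx.
  - by rewrite formC xf oner_eq0.
  - by rewrite free_involution ?seq1_free //= xe eqxx.
have fe : f ** e = f.
  rewrite im_mulC // ef formC (antifixed_orth fV ef).
  by rewrite mulr0 scale0r subr0 opprK.
have fx : f ** x = e - one.
  by rewrite im_mulC // fixed_mul_antifixed // xf; row_ring.
by rewrite fe fx ex memvB ?memv_span // !inE eqxx ?orbT.
Qed.

Lemma exists_isotropic : (2 < d)%N ->
  exists a, [/\ a \in V, a != 0 & '[a, a] = 0].
Proof.
move=> d_gt2.
have free_1e : free [:: one; e].
  have e0 : e != 0.
    by apply: (@comp_form_neq0 _ e); rewrite form_ee oppr_eq0 oner_eq0.
  by rewrite free_one_im ?seq1_free //= eV.
have [|z _ z_1e] := @dimv_lt_notin _ _ <<[:: one; e]>>%VS fullv.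
  by rewrite (eqP free_1e) dim_rV.
have [|//|c [zc onec ec]] := @form_interpolation [:: z; one; e] [:: 1; 0; 0].
  by rewrite free_cons z_1e.
have cV : c \in V by rewrite mem_cd_im formC onec.
have [ec_c|f0] := eqVneq (c - e ** c) 0.
  exists c; split=> //.
    by apply: (@comp_form_neq0 _ z); rewrite formC zc oner_eq0.
  by apply: fixed_isotropic; apply/esym/eqP; rewrite -subr_eq0 ec_c.
exists (c - e ** c); split=> //.
  by rewrite memvB // mem_cd_im im_form_mul1 // ec oppr0.
rewrite !formE formM form_ee (formC (e ** c)) im_form_mul_self //; ring.
Qed.
End Involution.

Lemma null_involution a c (e := a ** c + one) : a \in V -> c \in V ->
  '[a, a] = 0 -> '[a, c] = 1 ->
  [/\ e \in V, '[e, e] = -1, e ** a = - a &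
      forall b, b \in V -> a ** b = 0 -> '[b, c] = 0 -> e ** b = b].
Proof.
move=> aV cV aa ac.
have mul_e b : b \in V ->
    e ** b = - ((a ** b) ** c) - (2%:R * '[b, c]) *: a + b.
  move=> bV; rewrite /e !mulE; congr (_ + b).
  have := im_mul_anticommuter a bV cV; rewrite scaleNr => <-.
  by rewrite addKr.
split=> [|||b bV ab bc].
- by rewrite mem_cd_im !formE im_form_mul1 // ac addNr.
- rewrite !formE formM aa mul0r (formC one) im_form_mul1 // ac; ring.
- rewrite mul_e // im_sqr // aa ac oppr0 scale0r mul0x; row_ring.
- by rewrite mul_e // ab bc mul0x mulr0 scale0r !oppr0 !add0r.
Qed.

Lemma null_mul_neq0 a x y : a \in V -> x \in V -> y \in V ->
  '[a, a] = 0 -> a ** x = 0 -> a ** y = 0 -> free [:: a; x; y] -> x ** y != 0.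
Proof.
move=> aV xV yV aa ax ay free_axy.
have [||c [onec ac xc yc]] :=
    @form_interpolation [:: one; a; x; y] [:: 0; 1; 0; 0] => //.
  by rewrite free_one_im //= aV xV yV.
have cV : c \in V by rewrite mem_cd_im formC onec.
have [eV ee _ fixE] := null_involution aV cV aa ac.
apply: (fixed_mul_neq0 eV ee xV yV (fixE x xV ax xc) (fixE y yV ay yc)).
exact: (@catr_free _ _ [:: a]).
Qed.

Lemma block_null a b : a \in V -> b \in V -> free [:: a; b] -> '[a, a] = 0 ->
  a ** b = 0 ->
  exists e, [/\ e \in V, '[e, e] = -1, e ** b = b &
                cd_block A <<[:: e; a; b]>>].
Proof.
move=> aV bV free_ab aa ab.
have [||c [onec ac bc]] :=
    @form_interpolation [:: one; a; b] [:: 0; 1; 0] => //.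
  by rewrite free_one_im //= aV bV.
have cV : c \in V by rewrite mem_cd_im formC onec.
have [eV ee ea fixE] := null_involution aV cV aa ac.
have eb := fixE b bV ab bc.
exists (a ** c + one); split=> //; apply: block_span_im => //.
- apply: free_involution => //=.
  by rewrite (antifixed_orth eV aV ea) (fixed_orth eV bV eb) eqxx.
- by rewrite /= eV aV bV.
- by rewrite /= ea eb ab mem0v memvN !memv_span // !inE eqxx ?orbT.
Qed.

Lemma block_generic a b : a \in V -> b \in V -> free [:: a; b] ->
  ~~ dependent_pair a b ->
  cd_block A <<[:: a ** b + '[a, b] *: one; a; b]>>.
Proof.
move=> aV bV free_ab abN; set c := a ** b + _.
have cE : a ** b = c - '[a, b] *: one by rewrite addrK.
have cV : c \in V by rewrite mem_cd_im !formE im_form_mul1 // mulr1 addNr.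
have ca : c ** a = '[a, a] *: b - '[a, b] *: a.
  have ab_a : (a ** b) ** a = '[a, a] *: b - (2%:R * '[a, b]) *: a.
    apply: (addrI ((a ** a) ** b)); rewrite im_mul_anticommuter // im_sqr //.
    by rewrite !mulE; row_ring.
  by rewrite mulDl ab_a !mulE; row_ring.
have cb : c ** b = '[a, b] *: b - '[b, b] *: a.
  by rewrite !mulE im_mul_sqrr //; row_ring.
apply: block_span_im => //=; last 2 first.
- by rewrite cV aV bV.
- by rewrite ca cb cE !memvB ?memvZ ?memv_span // !inE eqxx ?orbT.
rewrite free_cons free_ab andbT; apply: contra abN => c_ab.
rewrite /dependent_pair cE memvB //; last by rewrite memvZ ?memv_span ?mem_head.
by rewrite span_cons (subvP (addvSr _ _)).
Qed.

Lemma block_dependent_pair a b (y z : F) : a \in V -> b \in V ->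
  free [:: a; b] -> z != 0 -> '[a, a] = - z ^+ 2 ->
  a ** b = - (y * z) *: one + y *: a + z *: b ->
  exists2 W, cd_block A W & (<<[:: a; b]>> <= W)%VS.
Proof.
move=> aV bV free_ab z0 aa abE; pose e := z^-1 *: a; pose x := y *: a + z *: b.
have eV : e \in V by apply: memvZ.
have ee : '[e, e] = -1 by rewrite !formE aa; field.
have xV : x \in V by rewrite memvD ?memvZ.
have x0 : x != 0 by apply: contraNneq z0 => /(free2_coef free_ab)[_ ->].
have ex : e ** x = x.
  by rewrite !mulE im_sqr // aa abE; row_field.
have [f _ blockW] := block_fixed eV ee xV ex x0.
exists <<[:: f; e; x]>>%VS => //; apply/span_subvP => w.
have bE : b = z^-1 *: x - y *: e by rewrite /x /e; row_field.
have aE : a = z *: e by rewrite scalerKV.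
have [eW xW] : e \in <<[:: f; e; x]>>%VS /\ x \in <<[:: f; e; x]>>%VS.
  by split; rewrite memv_span // !inE eqxx ?orbT.
rewrite !inE => /orP[]/eqP->; first by rewrite aE memvZ.
by rewrite bE; apply: memvB; apply: memvZ.
Qed.

Lemma block_cover P : (P <= V)%VS -> \dim P = 2%N ->
  exists2 W, cd_block A W & (P <= W)%VS.
Proof.
move=> /subvP PV /plane_span[a [b [free_ab /PV aV /PV bV ->]]].
have sub3 c : (<<[:: a; b]>> <= <<[:: c; a; b]>>)%VS.
  by rewrite [X in (_ <= X)%VS]span_cons addvSr.
have [abD|abN] := boolP (dependent_pair a b); last first.
  by eexists; [exact: block_generic abN | exact: sub3].
have [y [z [aa bb ab abE]]] := dependent_pair_mul aV bV free_ab abD.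
have [z0|z0] := eqVneq z 0; last exact: block_dependent_pair abE.
have [y0|y0] := eqVneq y 0.
  have {}ab : a ** b = 0 by rewrite abE z0 y0 mulr0 oppr0 !scale0r !addr0.
  have {}aa : '[a, a] = 0 by rewrite aa z0 expr2 mulr0 oppr0.
  have [e [_ _ _ blockW]] := block_null aV bV free_ab aa ab.
  by eexists; [exact: blockW | exact: sub3].
have swap : [:: b; a] =i [:: a; b] by move=> w; rewrite !inE orbC.
rewrite -(eq_span swap); apply: (@block_dependent_pair b a (- z) (- y)) => //.
- by rewrite free_pairC.
- by rewrite oppr_eq0.
- by rewrite sqrrN.
- rewrite im_mulC // abE ab; row_ring.
Qed.

(** * Uniqueness of blocks *)

Lemma cd_im_orthov : V = orthov form <[one]>.
Proof.
by apply/eqP; rewrite eqEsubv; apply/andP; split; apply/subvP => x;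
  rewrite mem_cd_im mem_orthov1.
Qed.

Lemma dim_imsub H : one \in H -> (\dim (cd_imsub A H)).+1 = \dim H.
Proof.
move=> oneH; rewrite /cd_imsub cd_im_orthov -eq_dim_orthov1 ?prednK //.
  rewrite lt0n dimv_eq0; apply: contraTneq oneH => ->.
  by rewrite memv0 comp_one_neq0.
by apply/mem_orthovPn; exists one; rewrite // form11 oner_eq0.
Qed.

Lemma dim_im : (\dim V).+1 = d.
Proof.
have := dim_imsub (memvf one); rewrite /cd_imsub capfv => ->.
exact: dim_rV.
Qed.

Definition pairwise_dependent W :=
  {in W &, forall a b, free [:: a; b] -> dependent_pair a b}.

Lemma anisotropic_dependent_mul w r : w \in V -> r \in V -> '[w, w] != 0 ->
  r != 0 -> '[r, w] = 0 -> (free [:: w; r] -> dependent_pair w r) ->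
  exists z : F, [/\ '[w, w] = - z ^+ 2, z != 0, w ** r = z *: r & '[r, r] = 0].
Proof.
move=> wV rV ww r0 rw dep_wr; have free_wr : free [:: w; r].
  apply: (free_cons_orth (f := form) (c := w)) => //=; first by rewrite rw eqxx.
  by rewrite seq1_free.
have [y [z [wwE rr wr wrE]]] :=
  dependent_pair_mul wV rV free_wr (dep_wr free_wr).
have z0 : z != 0.
  by apply: contraNneq ww => z0; rewrite wwE z0 expr2 mulr0 oppr0.
have y0 : y = 0.
  by apply/eqP; move/eqP: wr; rewrite formC rw eq_sym mulf_eq0 (negPf z0) orbF.
exists z; split=> //; last by rewrite rr y0 expr2 mulr0 oppr0.
by rewrite wrE y0 mul0r oppr0 !scale0r !add0r.
Qed.

Lemma anisotropic_pairwise_dependent_dim W w : (W <= V)%VS ->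
  pairwise_dependent W -> w \in W -> '[w, w] != 0 -> (\dim W <= 2)%N.
Proof.
move=> /subvP WV depW wW ww; rewrite leqNgt; apply/negP => dimW.
pose R := (W :&: orthov form <[w]>)%VS.
have eigenR r : r \in R -> r != 0 -> exists z : F,
    [/\ '[w, w] = - z ^+ 2, z != 0, w ** r = z *: r & '[r, r] = 0].
  rewrite memv_cap mem_orthov1 => /andP[rW /eqP rw] r0.
  by apply: anisotropic_dependent_mul; auto.
have [|x [y [free_xy xR yR]]] := @free_pair_sub _ _ R.
  apply: leq_trans (leq_dim_orthov1 _ _ _).
  by rewrite -ltnS prednK // (leq_trans _ dimW).
have [[xW _] [yW _]] := (memv_capP xR, memv_capP yR).
have [x0 y0] : x != 0 /\ y != 0.
  by split; rewrite (free_not0 free_xy) // !inE eqxx ?orbT.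
have xy0 : x + y != 0.
  apply: contra_eqN (oner_eq0 F) => /eqP xy.
  have [|-> _] := free2_coef (s := 1) (t := 1) free_xy; last by rewrite eqxx.
  by rewrite !scale1r.
have [z [ww_z z0 wx xx]] := eigenR x xR x0.
have [z' [_ _ wy yy]] := eigenR y yR y0.
have [z'' [_ _ wxy _]] := eigenR (x + y) (memvD xR yR) xy0.
have zz' : z = z' by apply: eigenvalue_eq free_xy wx wy _; rewrite -mulDr wxy.
rewrite -{}zz' in wy.
have xy : x ** y = 0 by apply: isotropic_dependent_mul; auto.
move/eqP: xy; apply/negP; apply: (@fixed_mul_neq0 (z^-1 *: w)); auto.
- by rewrite memvZ ?WV.
- by rewrite !formE ww_z; field.
- by rewrite mulZl wx scalerK.
- by rewrite mulZl wy scalerK.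
Qed.

Lemma pairwise_dependent_dim W : (W <= V)%VS -> pairwise_dependent W ->
  (\dim W <= 2)%N.
Proof.
move=> WV depW; rewrite leqNgt; apply/negP => dimW.
have [X [sizeX freeX XW]] := free_seq_sub dimW.
have [/allP isoX|/allPn[w /XW wW ww]] := boolP (all (fun u => '[u, u] == 0) X);
    last first.
  have := anisotropic_pairwise_dependent_dim WV depW wW ww.
  by rewrite leqNgt dimW.
case: X sizeX freeX XW isoX => [|a [|x [|y []]]] //= _ free_axy XW isoX.
have mulX u v : u \in [:: a; x; y] -> v \in [:: a; x; y] -> free [:: u; v] ->
    u ** v = 0.
  move=> uX vX free_uv; apply: isotropic_dependent_mul => //.
  - exact/(subvP WV)/XW.
  - exact/(subvP WV)/XW.
  - by apply: depW => //; apply: XW.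
  - exact/eqP/isoX.
  - exact/eqP/isoX.
have memV u : u \in [:: a; x; y] -> u \in V by move/XW; apply/subvP.
have free_ay : free [:: a; y].
  apply: (@catr_free _ _ [:: x]).
  by rewrite -(perm_free (permEl (perm_catCA [:: a] [:: x] [:: y]))).
have [aX xX yX] :
    [/\ a \in [:: a; x; y], x \in [:: a; x; y] & y \in [:: a; x; y]].
  by rewrite !inE !eqxx !orbT.
have /eqP := mulX x y xX yX (@catr_free _ _ [:: a] _ free_axy).
apply/negP; apply: (@null_mul_neq0 a) => //; try exact: memV.
- exact/eqP/isoX.
- by apply: mulX => //; apply: (@catl_free _ _ [:: y]).
- exact: mulX.
Qed.

Lemma subalg_generated a b H H' : cd_subalg A H -> cd_subalg A H' ->
  \dim H = 4%N -> \dim H' = 4%N -> a \in H -> b \in H -> a \in H' -> b \in H' ->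
  free [:: a ** b; one; a; b] -> H = H'.
Proof.
move=> [oneH mulH] [oneH' mulH'] dimH dimH' aH bH aH' bH' /eqP dim_gen.
have gen (K : {vspace 'rV[F]_d}) :
    one \in K -> (forall x y, x \in K -> y \in K -> x ** y \in K) ->
    \dim K = 4%N -> a \in K -> b \in K -> <<[:: a ** b; one; a; b]>>%VS = K.
  move=> oneK mulK dimK aK bK; apply/eqP.
  rewrite eqEdim dim_gen dimK leqnn andbT; apply/span_subvP => x.
  by rewrite !inE => /or4P[]/eqP->; auto.
by rewrite -(gen H) // -(gen H').
Qed.

Lemma subalg_independent_pair H : cd_subalg A H -> \dim H = 4%N ->
  exists a b, [/\ a \in cd_imsub A H, b \in cd_imsub A H, free [:: a; b] &
                  ~~ dependent_pair a b].
Proof.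
move=> [oneH _] dimH; apply: NNPP => no_pair.
have : (\dim (cd_imsub A H) <= 2)%N.
  apply: pairwise_dependent_dim => [|a b aH bH free_ab]; first exact: capvSr.
  by apply: contraT => abN; case: no_pair; exists a, b.
by rewrite -ltnS dim_imsub // dimH.
Qed.

Lemma block_eq W W' a b : cd_block A W -> cd_block A W' ->
  a \in W -> b \in W -> a \in W' -> b \in W' ->
  free [:: a; b] -> ~~ dependent_pair a b -> W = W'.
Proof.
move=> [H [subH dimH ->]] [H' [subH' dimH' ->]].
move=> /memv_capP[aH aV] /memv_capP[bH bV] /memv_capP[aH' _] /memv_capP[bH' _].
move=> free_ab abN.
rewrite (subalg_generated subH subH' dimH dimH' aH bH aH' bH') //.
by rewrite free_cons abN free_one_im //= aV bV.
Qed.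

Lemma block_determining_plane W : cd_block A W -> exists P : {vspace 'rV[F]_d},
  [/\ (P <= V)%VS, \dim P = 2%N &
      forall W', cd_block A W' -> (P <= W')%VS -> W' = W].
Proof.
move=> blockW; have [H [subH dimH WE]] := blockW.
have [a [b []]] := subalg_independent_pair subH dimH.
rewrite -WE => aW bW free_ab abN.
have [aV bV] : a \in V /\ b \in V.
  by split; [move: aW | move: bW]; rewrite WE => /memv_capP[].
exists <<[:: a; b]>>%VS; split; last 1 first.
- move=> W' blockW' /span_subvP abW'.
  by apply: (block_eq blockW' blockW _ _ aW bW free_ab abN); apply: abW';
    rewrite !inE eqxx ?orbT.
- by apply/span_subvP => x; rewrite !inE => /orP[]/eqP->.
- exact: eqP free_ab.
Qed.

Lemma division_independent_pair a b : cd_division A -> a \in V -> b \in V ->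
  free [:: a; b] -> ~~ dependent_pair a b.
Proof.
move=> divA aV bV free_ab; apply/negP.
move=> /(dependent_pair_mul aV bV free_ab)[y [z [_ _ _ abE]]].
have not_scalar c s : c \in V -> c != 0 -> c - s *: one != 0.
  move=> cV; apply: contra; rewrite subr_eq0 => /eqP cE.
  have := im_form1 cV; rewrite cE !formE mulr1 => ->.
  by rewrite scale0r.
have : (a - z *: one) ** (b - y *: one) = 0.
  rewrite !mulE abE; row_ring.
by case/divA => /eqP; apply/negP; apply: not_scalar => //;
  rewrite (free_not0 free_ab) // !inE eqxx ?orbT.
Qed.

Lemma division_block_unique P W W' : cd_division A ->
  (P <= V)%VS -> \dim P = 2%N -> cd_block A W -> cd_block A W' ->
  (P <= W)%VS -> (P <= W')%VS -> W = W'.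
Proof.
move=> divA /subvP PV /plane_span[a [b [free_ab aP bP _]]] blockW blockW'.
move=> /subvP PW /subvP PW'.
apply: (block_eq blockW blockW' (PW a aP) (PW b bP) (PW' a aP) (PW' b bP)) =>
  //.
exact: division_independent_pair (PV a aP) (PV b bP) free_ab.
Qed.

Lemma zero_divisor_isotropic u v : (2 < d)%N ->
  u ** v = 0 -> u != 0 -> v != 0 ->
  exists a, [/\ a \in V, a != 0 & '[a, a] = 0].
Proof.
move=> d_gt2 uv u0 v0; have uu : '[u, u] = 0.
  have /esym/eqP := comp_mul_conjl u v.
  by rewrite uv mulx0 scaler_eq0 (negPf v0) orbF => /eqP.
pose w := u - '[u, one] *: one.
have wV : w \in V by rewrite mem_cd_im !formE mulr1 subrr.
have [r0|r0] := eqVneq '[u, one] 0; first by exists u; rewrite mem_cd_im r0.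
apply: (@exists_isotropic ('[u, one]^-1 *: w)) => //; first exact: memvZ.
by rewrite /w !formE uu (formC one); field.
Qed.

Lemma isotropic_annihilator a : (4 < d)%N -> a \in V -> '[a, a] = 0 ->
  exists b, [/\ b \in V, a ** b = 0 & b \notin <[a]>%VS].
Proof.
move=> d_gt4 aV aa; pose K := lker (linfun (cdmul A a)).
have imK : (limg (linfun (cdmul A a)) <= K)%VS.
  apply/subvP => _ /memv_imgP[x _ ->]; rewrite memv_ker !lfunE /=.
  by rewrite im_mul_sqrl // aa oppr0 scale0r.
have dimK : (2 < \dim K)%N.
  have := limg_ker_dim (linfun (cdmul A a)) fullv.
  rewrite capfv dim_rV => dimE; rewrite ltnNge; apply/negP => K_le2.
  have := leq_add K_le2 (leq_trans (dimvS imK) K_le2).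
  by rewrite dimE leqNgt d_gt4.
have [|b /memv_capP[bK bV] bNa] := @dimv_lt_notin _ _ <[a]> (K :&: V).
  rewrite dim_vline cd_im_orthov; apply: leq_ltn_trans (leq_b1 _) _.
  apply: leq_trans (leq_dim_orthov1 _ _ _).
  by rewrite -ltnS prednK // (leq_trans _ dimK).
exists b; split=> //.
by move: bK; rewrite memv_ker lfunE => /eqP.
Qed.

Lemma block_unique_division : (4 < d)%N ->
  (forall P, (P <= V)%VS -> \dim P = 2%N ->
     exists W, [/\ cd_block A W, (P <= W)%VS &
                   forall W', cd_block A W' -> (P <= W')%VS -> W' = W]) ->
  cd_division A.
Proof.
move=> d_gt4 uniqP u v uv.
have [|u0] := eqVneq u 0; first by left.
have [|v0] := eqVneq v 0; [by right | exfalso].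
have d_gt2 : (2 < d)%N by apply: leq_trans d_gt4.
have [a [aV a0 aa]] := zero_divisor_isotropic d_gt2 uv u0 v0.
have [b [bV ab bNa]] := isotropic_annihilator d_gt4 aV aa.
have free_ab : free [:: a; b].
  by rewrite free_pairC free_cons span_seq1 bNa seq1_free.
have b0 : b != 0 by rewrite (free_not0 free_ab) // !inE eqxx orbT.
have [e [eV ee eb block_ab]] := block_null aV bV free_ab aa ab.
have [f bf block_f] := block_fixed eV ee bV eb b0.
have [||W [_ _ uniqW]] := uniqP <<[:: e; b]>>%VS.
- by apply/span_subvP => x; rewrite !inE => /orP[]/eqP->.
- apply: eqP; apply: free_involution => //=; rewrite ?bV ?seq1_free //.
  by rewrite (fixed_orth eV bV eb) eqxx.
have fW : f \in <<[:: e; a; b]>>%VS.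
  rewrite (uniqW _ block_ab); last first.
    by apply: sub_span => x; rewrite !inE => /orP[]->; rewrite ?orbT.
  rewrite -(uniqW _ block_f); first by rewrite memv_span ?mem_head.
  by apply: sub_span => x; rewrite !inE => ->; rewrite orbT.
move: fW; apply/negP/(notin_span_orth (f := form) (c := b)); last first.
  by rewrite formC bf oner_eq0.
rewrite /= formC (fixed_orth eV bV eb) (im_mul_orth aV) ?ab ?mem0v //.
by rewrite (fixed_isotropic eV eb) eqxx.
Qed.
End CompositionAlgebra.

(** * Cayley algebras *)

Section BaseAlgebra.
Variable F : fieldType.
Local Notation base := (CD_base F).

Definition CD_base_form (x y : 'rV[F]_1) : F := x 0 0 * y 0 0.

Lemma CD_base_form_bilinear : bilinear_for *%R (idfun \; *%R) CD_base_form.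
Proof. by split=> x s u v; rewrite /CD_base_form !mxE /=; ring. Qed.

Lemma CD_base_form_hermitian x y :
  CD_base_form x y = (-1) ^+ false * idfun (CD_base_form y x).
Proof. by rewrite mul1r /CD_base_form mulrC. Qed.

HB.instance Definition _ := bilinear_isBilinear.Build F
  'rV[F]_1 'rV[F]_1 F *%R (idfun \; *%R) CD_base_form CD_base_form_bilinear.
HB.instance Definition _ := isHermitianSesquilinear.Build F
  'rV[F]_1 false idfun CD_base_form CD_base_form_hermitian.

Lemma CD_base_conj : cd_conj base =1 id.
Proof. exact: mulmx1. Qed.

Lemma CD_base_commutative : commutative (cdmul base).
Proof. by move=> x y; rewrite /= mulrC. Qed.

Lemma CD_base_associative : associative (cdmul base).
Proof. by move=> x y z; rewrite /= !mxE !mulr1n mulrA. Qed.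

Lemma CD_base_composition : composition_form base CD_base_form.
Proof.
have ext (x y : 'rV[F]_1) : x 0 0 = y 0 0 -> x = y.
  by move=> xy; apply/rowP => i; rewrite ord1.
split=> [y s u v|x s u v|x|x|||x y|x].
- by apply: ext; rewrite /= !mxE !mulr1n; ring.
- by apply: ext; rewrite /= !mxE !mulr1n; ring.
- by apply: ext; rewrite /= !mxE !mulr1n; ring.
- by apply: ext; rewrite /= !mxE !mulr1n; ring.
- rewrite /nondegenerate -subv0; apply/subvP => x.
  move=> /mem_orthovP/(_ 1%:M (memvf _)).
  rewrite /= /CD_base_form [X in _ * X = _]mxE mulr1 memv0 => x0.
  by apply/eqP; apply: ext; rewrite x0 mxE.
- by rewrite /= /CD_base_form !mxE mulr1n mulr1.
- by rewrite /= /CD_base_form !mxE !mulr1n; ring.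
- by apply: ext; rewrite CD_base_conj /= /CD_base_form !mxE !mulr1n; ring.
Qed.
End BaseAlgebra.

Lemma Cayley_composition (F : fieldType) (al be ga : F) : 2%:R != 0 :> F ->
  al != 0 -> be != 0 -> ga != 0 ->
  exists form, composition_form (Cayley al be ga) form.
Proof.
move=> two_neq0 al0 be0 ga0.
have comp1 := CD_base_composition F.
have [mul1C mul1A] := (@CD_base_commutative F, @CD_base_associative F).
have comp2 := CD_double_composition comp1 two_neq0 al0 mul1A.
have mul2C := CD_double_commutative al mul1C (@CD_base_conj F).
have mul2A := CD_double_associative comp1 two_neq0 al mul1C mul1A.
have comp4 := CD_double_composition comp2 two_neq0 be0 mul2A.
have mul4A := CD_double_associative comp2 two_neq0 be mul2C mul2A.
exact: ex_intro (CD_double_composition comp4 two_neq0 ga0 mul4A).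
Qed.

Theorem mainTheorem2 (F : fieldType) (al be ga : F) :
  (2%:R : F) != 0 -> al != 0 -> be != 0 -> ga != 0 ->
  let O := Cayley al be ga in
  let V := cd_im O in
  (* (V, B) is a (7,3,2) q-covering design *)
  [/\ \dim V = 7%N,
      (forall W, cd_block O W -> (W <= V)%VS /\ \dim W = 3%N),
      (forall P : {vspace 'rV[F]_cdim8}, (P <= V)%VS -> \dim P = 2%N ->
         exists2 W, cd_block O W & (P <= W)%VS),
      (* inclusion-minimality: every subcollection that covers is all of B *)
      (forall C : {vspace 'rV[F]_cdim8} -> Prop,
         (forall W, C W -> cd_block O W) ->
         (forall P : {vspace 'rV[F]_cdim8}, (P <= V)%VS -> \dim P = 2%N ->
            exists2 W, C W & (P <= W)%VS) ->
         forall W, cd_block O W -> C W)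
    & (* 2-(7,3,1) subspace design iff O is a division algebra *)
      ((forall P : {vspace 'rV[F]_cdim8}, (P <= V)%VS -> \dim P = 2%N ->
          exists W, [/\ cd_block O W, (P <= W)%VS &
                        forall W', cd_block O W' -> (P <= W')%VS -> W' = W])
       <-> cd_division O)].
Proof.
move=> two_neq0 al0 be0 ga0 O V.
have [form compO] : exists form, composition_form O form.
  exact: Cayley_composition.
split.
- by apply: succn_inj; rewrite (dim_im compO two_neq0).
- move=> _ [H [[oneH _] dimH ->]]; split; first exact: capvSr.
  by apply: succn_inj; rewrite (dim_imsub compO two_neq0).
- exact: block_cover compO two_neq0.
- move=> C C_block C_cover W blockW.
  have [P [PV dimP uniqW]] := block_determining_plane compO two_neq0 blockW.
  have [W' CW' PW'] := C_cover P PV dimP.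
  by rewrite -(uniqW W' (C_block W' CW') PW').
split=> [|divO P PV dimP]; first exact: block_unique_division compO two_neq0 _.
have [W blockW PW] := block_cover compO two_neq0 PV dimP.
exists W; split=> // W' blockW' PW'.
exact: (division_block_unique compO two_neq0 divO PV).
Qed.
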